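(* (a) $\mathcal M_{I^1}=\mathcal M$, where $I^1\in\mathbb I$ is the partition of $\omega$ into singletons. (b) For all $I\in\mathbb I$, $\mathcal M_I\subseteq\mathcal M$ and $\mathcal M_I\le_{\mathrm T}\mathcal M$.
   Context: $\mathcal M$ is the ideal of meager subsets of ${}^\omega2$. $\forall^\infty n$ means ''for all but finitely many $n<\omega$''. $\mathbb I$ is the set of partitions $I=\langle I_n:n<\omega\rangle$ of $\omega$ into consecutive nonempty (finite) intervals. For $I,J\in\mathbb I$ and $y\in{}^\omega2$, $$A^I_{J,y}:=\{x\in{}^\omega2:\forall^\infty n<\omega\ \exists k<\omega\colon I_k\subseteq J_n\text{ and }x{\upharpoonright}I_k=y{\upharpoonright}I_k\},$$ and $\mathcal M_I:=\{X\subseteq{}^\omega2:\exists (J,y)\in\mathbb I\times{}^\omega2\colon X\subseteq A^I_{J,y}\}$. For families $\mathcal I,\mathcal J$ of sets ordered by inclusion, $\mathcal I\le_{\mathrm T}\mathcal J$ means that there are functions $\Psi_-\colon\mathcal I\to\mathcal J$ and $\Psi_+\colon\mathcal J\to\mathcal I$ such that $\Psi_-(A)\subseteq B$ implies $A\subseteq\Psi_+(B)$ for all $A\in\mathcal I$, $B\in\mathcal J$. *)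

(* Defs.v *)
From mathcomp Require Import all_boot.
From mathcomp Require Import boolp classical_sets functions cardinality.
From mathcomp Require Import topology cantor.

Set Implicit Arguments.
Unset Strict Implicit.
Unset Printing Implicit Defensive.

Local Open Scope classical_set_scope.

Definition nowhere_dense (T : topologicalType) (X : set T) : Prop :=
  interior (closure X) = set0.

Definition meager (T : topologicalType) (X : set T) : Prop :=
  exists F : nat -> set T,
    (forall n, nowhere_dense (F n)) /\ X `<=` \bigcup_n F n.

Definition meager_ideal : set (set cantor_space) :=
  [set X | meager X].

(* Nonemptiness of the blocks is part of [partition]. *)
Record interval_partition := IntervalPartition {
  block :> nat -> set nat ;
  block_partition : partition [set: nat] block [set: nat] ;
  block_interval : forall n,
    exists a b : nat, block n = [set k | a <= k < b] ;
  block_consecutive : forall m n i j,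
    m < n -> block m i -> block n j -> i < j
}.

Definition singleton_block (n : nat) : set nat := [set n].

Lemma singleton_block_partition :
  partition [set: nat] singleton_block [set: nat].
Proof.
split.
- by apply/seteqP; split => // n _; exists n.
- by move=> i j _ _ [k [/= -> ->]].
- by move=> i _; exists i.
Qed.

Lemma singleton_block_interval n :
  exists a b : nat, singleton_block n = [set k | a <= k < b].
Proof.
exists n, n.+1; apply/seteqP; split => [k -> /=|k /=]; first by rewrite leqnn ltnS leqnn.
by rewrite ltnS -eqn_leq => /eqP.
Qed.

Lemma singleton_block_consecutive m n i j :
  m < n -> singleton_block m i -> singleton_block n j -> i < j.
Proof. by move=> mn -> ->. Qed.

Definition singleton_partition : interval_partition :=
  IntervalPartition singleton_block_partition singleton_block_interval
    singleton_block_consecutive.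

Definition matching_set (I J : interval_partition) (y : cantor_space) :
    set cantor_space :=
  [set x | \forall n \near \oo,
     exists k, I k `<=` J n /\ (forall i, I k i -> x i = y i)].

Definition matching_family (I : interval_partition) : set (set cantor_space) :=
  [set X | exists (J : interval_partition) (y : cantor_space),
     X `<=` matching_set I J y].

(* [{fun A >-> B}] is the type of total functions mapping [A] into [B];
   their values outside [A] are irrelevant here. *)
Definition tukey_le (S T : Type) (A : set (set S)) (B : set (set T)) : Prop :=
  exists (f : {fun A >-> B}) (g : {fun B >-> A}),
    forall X Y, A X -> B Y -> f X `<=` Y -> X `<=` g Y.

(* Main.v *)
Require Import Defs.
From mathcomp Require Import all_boot.
From mathcomp Require Import boolp classical_sets functions.
From mathcomp Require Import topology cantor.

(** Call [y] a match for [x] at [i] when [x i = y i]. The idea is that the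
    meager sets are exactly the sets covered by
    [matching_set singleton_partition J y], whose elements match [y] somewhere
    in almost every block of [J].

    Such a set is meager ([meager_matching_set]): matching [y] in every block
    beyond the [N]-th is nowhere dense, because any finite condition can be
    prolonged so as to be opposite to [y] on a whole later block. Conversely
    ([meager_sub_matching_set]), let [X] be covered by nowhere dense sets
    [F 0], [F 1], and so on. For given [n] and [k] there is one finite pattern
    on an interval [[k, k')] such that nobody carrying this pattern lies in
    [F 0], ..., [F (n - 1)], whatever happens below [k]
    ([nowhere_dense_avoid]). Stack these intervals to get [J], and let [y] be
    opposite to the patterns: an element of [F j] cannot carry the pattern of a
    block of index greater than [j], so it matches [y] there. This proves (a).

    For (b), matching on a whole block of [I] inside a block of [J] implies
    matching at a point, so each matching set for [I] lies inside the one for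
    singletons with the same [J] and [y]. The Tukey connection only replaces
    [I] by the singletons, or conversely, while keeping the pair: [X] covered
    through [(J, y)] is sent to the meager set of [(J, y)], and a meager [Y]
    covered through [(K, z)] is sent to the matching set of [I], [K], [z]. It
    works because an inclusion between matching sets for singletons has a
    combinatorial reason ([matching_set_sub_agree]): almost every block of [K]
    contains a block of [J] on which [y] and [z] agree. This reason does not
    mention the singletons, and it yields the inclusion for every [I]
    ([matching_set_sub_lift]). *)

Set Implicit Arguments.
Unset Strict Implicit.
Unset Printing Implicit Defensive.

Local Open Scope classical_set_scope.

(** * Cylinders and nowhere dense sets of the Cantor space *)

Definition cylinder (x : cantor_space) (k : nat) : set cantor_space :=
  [set z | forall i, i < k -> z i = x i].

Definition splice (k : nat) (x y : cantor_space) : cantor_space :=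
  fun i => if i < k then x i else y i.

Lemma cylinder_splice k x y : cylinder x k (splice k x y).
Proof. by move=> i ik; rewrite /splice ik. Qed.

Lemma nbhs_cylinder x k : nbhs x (cylinder x k).
Proof.
elim: k => [|k IHk]; first by apply: filterS filterT => z _ i.
have xk : nbhs x [set z : cantor_space | z k = x k].
  exact: (@proj_continuous nat (fun=> bool) k x _ (discrete_set1 (x k))).
apply: filterS (filterI IHk xk) => z [zx zk] i.
by rewrite ltnS leq_eqVlt => /predU1P[->//|/zx].
Qed.

(** The cylinders at [x] form a filter base, and that filter converges to [x]
    as soon as it does so in each coordinate. *)
Lemma nbhs_cylinderP x (A : set cantor_space) :
  nbhs x A <-> exists k, cylinder x k `<=` A.
Proof.
split=> [|[k sub]]; last exact: filterS (nbhs_cylinder x k).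
pose F := filter_from [set: nat] (cylinder x).
have FF : Filter F.
  apply: filter_from_filter; first by exists 0.
  move=> i j _ _; exists (maxn i j) => // z zx; split=> l lt_l; apply: zx.
    by rewrite (leq_trans lt_l) ?leq_maxl.
  by rewrite (leq_trans lt_l) ?leq_maxr.
suff cvgF : F --> x by move=> /cvgF[k _ sub]; exists k.
apply/cvg_sup => i U [_ [[V _ <-] Vx sub]]; exists i.+1 => // z zx.
by apply: sub; rewrite /= zx.
Qed.

(** Nowhere density as an extension property: every finite condition can be
    prolonged to one that forbids membership in [F]. *)
Lemma nowhere_dense_cylinderP (F : set cantor_space) :
  nowhere_dense F <-> forall x k, exists x' k',
    [/\ k <= k', cylinder x k x' & cylinder x' k' `<=` ~` F].
Proof.
split=> [ndF x k | H].
  have : ~ cylinder x k `<=` closure F.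
    move=> sub; suff : interior (closure F) x by rewrite ndF.
    by apply: filterS sub _; exact: nbhs_cylinder.
  move=> /existsNP[z /not_implyP[xz]].
  rewrite -[closure F]setCK -interiorC => /contrapT/nbhs_cylinderP[l sub].
  exists z, (maxn k l); split; rewrite ?leq_maxl // => w zw; apply: sub => i il.
  by apply: zw; rewrite (leq_trans il) ?leq_maxr.
rewrite /nowhere_dense -subset0 => x /nbhs_cylinderP[k sub].
have [x' [k' [_ xx' disj]]] := H x k.
by have [z [Fz /disj]] := sub x' xx' _ (nbhs_cylinder x' k').
Qed.

Lemma nowhere_dense_subset (F G : set cantor_space) :
  F `<=` G -> nowhere_dense G -> nowhere_dense F.
Proof.
move=> FG /nowhere_dense_cylinderP ndG; apply/nowhere_dense_cylinderP => x k.
have [x' [k' [kk' xx' disj]]] := ndG x k; exists x', k'; split=> //.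
by move=> z /disj nGz /FG.
Qed.

Lemma nowhere_denseU (F G : set cantor_space) :
  nowhere_dense F -> nowhere_dense G -> nowhere_dense (F `|` G).
Proof.
move=> /nowhere_dense_cylinderP ndF /nowhere_dense_cylinderP ndG.
apply/nowhere_dense_cylinderP => x k.
have [x1 [k1 [kk1 xx1 disjF]]] := ndF x k.
have [x2 [k2 [kk2 xx2 disjG]]] := ndG x1 k1.
exists x2, k2; split; first exact: leq_trans kk2.
  by move=> i ik; rewrite xx2 ?xx1 // (leq_trans ik).
move=> z zx2 [|]; last exact: disjG.
by apply: disjF => i ik; rewrite zx2 ?xx2 // (leq_trans ik).
Qed.

Lemma nowhere_dense_bigcup (F : nat -> set cantor_space) n :
  (forall j, nowhere_dense (F j)) -> nowhere_dense (\bigcup_(j in `I_n) F j).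
Proof.
move=> ndF; elim: n => [|n IHn].
  by apply: nowhere_dense_subset (ndF 0) => z [].
apply: nowhere_dense_subset (nowhere_denseU IHn (ndF n)) => z [j /=].
by rewrite ltnS leq_eqVlt => /predU1P[->|jn] Fz; [right | left; exists j].
Qed.

(** * Patterns avoiding a nowhere dense set *)

Definition flip (k : nat) (z : cantor_space) : cantor_space :=
  fun i => if i == k then ~~ z i else z i.

Lemma flipK k : involutive (flip k).
Proof.
by move=> z; apply/funext => i; rewrite /flip; case: eqP => //; rewrite negbK.
Qed.

Lemma cylinder_flip j k x z :
  cylinder x k z -> cylinder (flip j x) k (flip j z).
Proof. by move=> xz i /xz zx; rewrite /flip zx. Qed.

Lemma nowhere_dense_flip k (F : set cantor_space) :
  nowhere_dense F -> nowhere_dense (flip k @^-1` F).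
Proof.
move=> /nowhere_dense_cylinderP ndF; apply/nowhere_dense_cylinderP => x l.
have [x' [l' [ll' xx' disj]]] := ndF (flip k x) l.
exists (flip k x'), l'; split=> //.
  by rewrite -[x](flipK k); exact: cylinder_flip.
by move=> z /(cylinder_flip k); rewrite flipK => /disj.
Qed.

Definition tail_saturation (k : nat) (F : set cantor_space) :
    set cantor_space :=
  [set z | exists2 w, F w & forall i, k <= i -> w i = z i].

(** The saturation is the union of the finitely many images of [F] under
    changes of coordinates below [k], and each change of one coordinate is a
    homeomorphism. The induction adds one coordinate at a time. *)
Lemma nowhere_dense_tail_saturation k F :
  nowhere_dense F -> nowhere_dense (tail_saturation k F).
Proof.
move=> ndF; elim: k => [|k IHk].
  apply: nowhere_dense_subset ndF => z [w Fw wz].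
  by have <- : w = z by apply/funext => i; exact: wz.
apply: nowhere_dense_subset (nowhere_denseU IHk (nowhere_dense_flip k IHk)).
move=> z [w Fw wz]; have [wzk|wzk] := eqVneq (w k) (z k).
  by left; exists w => // i; rewrite leq_eqVlt => /predU1P[<- //|/wz].
right; exists w => // i; rewrite leq_eqVlt => /predU1P[<-|ki].
  by rewrite /flip eqxx; case: (w k) (z k) wzk => -[].
by rewrite /flip gtn_eqF // wz.
Qed.

(** A pattern leaving the saturation of [F] works for all the beginnings below
    [k] at once. *)
Lemma nowhere_dense_avoid (F : set cantor_space) k : nowhere_dense F ->
  exists k' s, k < k' /\
    forall z, (forall i, k <= i < k' -> z i = s i) -> ~ F z.
Proof.
move=> /(nowhere_dense_tail_saturation k)/nowhere_dense_cylinderP.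
move=> /(_ (fun=> false) k)[s [k' [kk' _ disj]]].
(* The cylinder may give [k' = k]; the successor keeps the interval nonempty. *)
exists k'.+1, s; split=> [|z zs Fz]; first by rewrite ltnS.
apply: (disj (splice k s z)) => [i ik'|].
  rewrite /splice; case: ltnP => // ki.
  by rewrite zs // ki ltnS ltnW.
by exists z => // i ki; rewrite /splice ltnNge ki.
Qed.

(** * Interval partitions *)

Lemma block_nonempty (J : interval_partition) n : J n !=set0.
Proof. by case: (block_partition J) => _ _; apply. Qed.

Lemma block_cover (J : interval_partition) i : exists n, J n i.
Proof.
case: (block_partition J) => cov _ _.
have : [set: nat] i by [].
by rewrite -cov => -[n _ Jni]; exists n.
Qed.

Lemma block_unique (J : interval_partition) m n i : J m i -> J n i -> m = n.
Proof.
by move=> Jmi Jni; case: (block_partition J) => _ + _; apply=> //; exists i.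
Qed.

Lemma block_convex (J : interval_partition) n i j l :
  J n i -> J n j -> i <= l <= j -> J n l.
Proof.
have [a [b ->]] := block_interval J n => /= /andP[ai _] /andP[_ jb].
by move=> /andP[il lj]; rewrite (leq_trans ai) // (leq_ltn_trans lj).
Qed.

Lemma block_bounded (J : interval_partition) n :
  exists b, forall i, J n i -> i < b.
Proof.
by have [a [b ->]] := block_interval J n; exists b => i /= /andP[].
Qed.

Lemma block_ge (J : interval_partition) n i : J n i -> n <= i.
Proof.
elim: n i => // n IHn i Ji; have [j Jj] := block_nonempty J n.
exact: leq_ltn_trans (IHn _ Jj) (block_consecutive (ltnSn n) Jj Ji).
Qed.

Lemma interval_partition_of_endpoints (c : nat -> nat) :
  c 0 = 0 -> (forall n, c n < c n.+1) ->
  exists J : interval_partition, forall n, J n = [set i | c n <= i < c n.+1].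
Proof.
move=> c0 cS; pose B n := [set i | c n <= i < c n.+1].
have c_mono : {mono c : m n / m <= n} 
    by apply: leq_mono; apply: homo_ltn cS; exact: ltn_trans.
have B_cons m n i j : m < n -> B m i -> B n j -> i < j.
  rewrite -c_mono => le_mn /andP[_ im] /andP[nj _].
  exact: leq_trans im (leq_trans le_mn nj).
have B_part : partition [set: nat] B [set: nat].
  split=> [|m n _ _ [i [Bm Bn]]|n _];
    last by exists (c n); rewrite /B /= leqnn cS.
    apply/seteqP; split=> // i _.
    have ex : exists n, i < c n.
      exists i.+1; elim: i => [|i /leq_ltn_trans]; last exact.
      exact: leq_trans (cS 0).
    case: (ex_minnP ex) => -[|n]; first by rewrite c0.
    move=> lt_i min; exists n => //; apply/andP; split=> //.
    by rewrite leqNgt; apply/negP => /min; rewrite ltnn.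
  have [lt|lt|//] := ltngtP m n.
    by have := B_cons _ _ _ _ lt Bm Bn; rewrite ltnn.
  by have := B_cons _ _ _ _ lt Bn Bm; rewrite ltnn.
have B_int n : exists a b, B n = [set k | a <= k < b] by exists (c n), (c n.+1).
by exists (IntervalPartition B_part B_int B_cons).
Qed.

(** * Matching sets for singletons are the basic meager sets *)

Lemma matching_set_singletonP (J : interval_partition) (y x : cantor_space) :
  matching_set singleton_partition J y x <->
  \forall n \near \oo, exists2 i, J n i & x i = y i.
Proof.
split; apply: filterS => n.
  by move=> [k [sub xy]]; exists k; [exact: sub | exact: xy].
by move=> [i Ji xy]; exists i; split=> [_ ->|_ ->].
Qed.

Lemma matching_set_sub_singleton I J y :
  matching_set I J y `<=` matching_set singleton_partition J y.
Proof.
move=> x xy; apply/matching_set_singletonP; apply: filterS xy => n [k [sub xy]].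
by have [i Iki] := block_nonempty I k; exists i; [exact: sub | exact: xy].
Qed.

Lemma meager_matching_set J y : meager (matching_set singleton_partition J y).
Proof.
exists (fun N => [set x | forall n, N <= n -> exists2 i, J n i & x i = y i]).
split=> [N|x /matching_set_singletonP[N _ xy]]; last by exists N.
apply/nowhere_dense_cylinderP => x k; pose n := maxn N k.
have [b Jb] := block_bounded J n.
exists (splice k x (fun i => ~~ y i)), (maxn k b).
split; [exact: leq_maxl|exact: cylinder_splice|].
move=> z zx /(_ n (leq_maxl _ _))[i Ji].
rewrite zx ?leq_max ?(Jb _ Ji) ?orbT // /splice ltnNge.
by rewrite (leq_trans (leq_maxr N k) (block_ge Ji)) /=; case: (y i).
Qed.

(** The blocks come from a recursion: the right end of block [n] is where a
    pattern that starts at its left end and avoids [F 0], ..., [F (n - 1)]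
    stops. *)
Lemma meager_sub_matching_set X : meager X ->
  exists J y, X `<=` matching_set singleton_partition J y.
Proof.
move=> [F [ndF XF]].
have step n k : exists p : nat * cantor_space, k < p.1 /\ forall z,
    (forall i, k <= i < p.1 -> z i = p.2 i) -> ~ (\bigcup_(j in `I_n) F j) z.
  have [k' [s ?]] := nowhere_dense_avoid k (nowhere_dense_bigcup n ndF).
  by exists (k', s).
have [h hP] := choice (fun nk => step nk.1 nk.2).
pose c := fix c n := if n is m.+1 then (h (m, c m)).1 else 0.
have cS n : c n < c n.+1 by case: (hP (n, c n)).
have [J JE] := interval_partition_of_endpoints (erefl (c 0)) cS.
have [idx idxP] := choice (block_cover J).
pose y : cantor_space := fun i => ~~ (h (idx i, c (idx i))).2 i.
exists J, y => x /XF[j _ Fx]; apply/matching_set_singletonP.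
exists j.+1 => // n /= jn; apply: contrapT => nomatch.
case: (hP (n, c n)) => _ /= /(_ x); apply; last by exists j.
move=> i cni; have Ji : J n i by rewrite JE.
have : x i <> y i by move=> xy; apply: nomatch; exists i.
rewrite /y (block_unique (idxP i) Ji).
by case: (x i) ((h _).2 i) => -[] // [].
Qed.

(** * Inclusions between matching sets *)

(** Were the conclusion to fail for infinitely many [n], one could let [x] be
    opposite to [z] on those blocks [K n] and equal to [y] elsewhere. Then [x]
    is not in the set of [K] and [z], and it should be in the set of [J] and
    [y]: a block of [J] inside a bad block has a point where [y] differs from
    [z], so that [x] matches [y] there, and any other block of [J] should have
    a point outside the bad blocks. The latter could fail if bad blocks were
    adjacent; so the failures are treated for [n] of one parity at a time,
    which leaves a block without changes between any two bad ones. *)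
Lemma matching_set_sub_agree (J K : interval_partition) y z :
  matching_set singleton_partition J y `<=`
    matching_set singleton_partition K z ->
  \forall n \near \oo,
    exists m, J m `<=` K n /\ forall i, J m i -> y i = z i.
Proof.
move=> sub; pose P n := exists m, J m `<=` K n /\ forall i, J m i -> y i = z i.
suff parity b : \forall n \near \oo, odd n = b -> P n.
  apply: filterS2 (parity true) (parity false) => n.
  by case: (odd n) => [/(_ erefl)|_ /(_ erefl)].
pose bad n := odd n = b /\ ~ P n.
pose x : cantor_space :=
  fun i => if `[< exists2 n, bad n & K n i >] then ~~ z i else y i.
suff /sub/matching_set_singletonP : matching_set singleton_partition J y x.
  apply: filterS => n [i Kni] + nb; apply: contraPP => nPn; rewrite /x.
  by case: asboolP => [_|]; [case: (z i) | case; exists n].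
apply/matching_set_singletonP; exists 0 => // m _; apply: contrapT => nomatch.
have Jbad i : J m i -> x i <> y i /\ exists2 n, bad n & K n i.
  move=> Ji; have xy : x i <> y i by move=> xy; apply: nomatch; exists i.
  by split=> //; move: xy; rewrite /x; case: asboolP.
(* Otherwise [J m] would contain the block [K n.+1], whose parity is wrong
   for being bad. *)
have order n n' i j : J m i -> J m j -> bad n -> bad n' -> K n i -> K n' j ->
    ~ n < n'.
  move=> Ji Jj [nb _] [n'b _] Ki Kj lt.
  have lt' : n.+1 < n'.
    rewrite ltn_neqAle lt andbT; apply: contra_eq_neq n'b => <-.
    by rewrite /= nb; case: (b).
  have [l Kl] := block_nonempty K n.+1.
  have il := block_consecutive (ltnSn n) Ki Kl.
  have lj := block_consecutive lt' Kl Kj.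
  have Jl : J m l by apply: block_convex Ji Jj _; rewrite (ltnW il) (ltnW lj).
  have [_ [n'' [n''b _] Kl']] := Jbad l Jl.
  by move: n''b; rewrite (block_unique Kl' Kl) /= nb; case: (b).
have [i Ji] := block_nonempty J m; have [_ [n badn Kni]] := Jbad i Ji.
case: (badn) => _; apply; exists m.
split=> j Jj; have [xy [n' badn' Kj]] := Jbad j Jj.
  have [lt|lt|-> //] := ltngtP n n'.
    by case: (order _ _ _ _ Ji Jj badn badn' Kni Kj).
  by case: (order _ _ _ _ Jj Ji badn' badn Kj Kni).
move: xy; rewrite /x; case: asboolP => [_|]; last by case; exists n'.
by case: (z j) (y j) => -[] // [].
Qed.

(** For large [n], the block [J m] inside [K n] has a large index, so that it
    contains a block of [I] where [x] is equal to [y], hence to [z]. *)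
Lemma matching_set_sub_lift I (J K : interval_partition) y z :
  matching_set singleton_partition J y `<=`
    matching_set singleton_partition K z ->
  matching_set I J y `<=` matching_set I K z.
Proof.
move=> /matching_set_sub_agree[N _ agree] x [M _ xy].
(* Beyond [b], only blocks of [J] of index at least [M] occur. *)
have [b Jb] : exists b, forall m i, m < M -> J m i -> i < b.
  elim: M {xy} => [|M [b Jb]]; first by exists 0.
  have [b' Jb'] := block_bounded J M; exists (maxn b b') => m i.
  rewrite ltnS leq_eqVlt leq_max => /predU1P[->/Jb'->|mM Ji]; first exact: orbT.
  by rewrite (Jb m).
exists (maxn N b) => // n /=; rewrite geq_max => /andP[Nn bn].
have [m [JK yz]] := agree n Nn.
have Mm : M <= m.
  rewrite leqNgt; apply/negP => mM; have [i Ji] := block_nonempty J m.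
  have ni := block_ge (JK _ Ji).
  by have := leq_trans (Jb _ _ mM Ji) (leq_trans bn ni); rewrite ltnn.
have [k [IJ xk]] := xy m Mm; exists k; split=> [i /IJ/JK //|i Ii].
by rewrite xk // yz //; exact: IJ.
Qed.

(** * The Tukey connection *)

Lemma choose_matching_set I :
  exists c : set cantor_space -> interval_partition * cantor_space,
  forall X, matching_family I X -> X `<=` matching_set I (c X).1 (c X).2.
Proof.
suff /choice[c cP] : forall X, exists p : interval_partition * cantor_space,
    matching_family I X -> X `<=` matching_set I p.1 p.2 by exists c.
move=> X; have [[J [y sub]]|no] := pselect (matching_family I X).
  by exists (J, y).
by exists (singleton_partition, fun=> false).
Qed.

Theorem lemma3p12 :
  matching_family singleton_partition = meager_ideal /\
  (forall I : interval_partition,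
     matching_family I `<=` meager_ideal /\
     tukey_le (matching_family I) meager_ideal).
Proof.
have sub_meager I : matching_family I `<=` meager_ideal.
  move=> X [J [y /subset_trans/(_ (@matching_set_sub_singleton I J y)) sub]].
  have [F [ndF MF]] := meager_matching_set J y.
  by exists F; split=> //; exact: subset_trans MF.
have eq_meager : matching_family singleton_partition = meager_ideal.
  apply/seteqP; split; first exact: sub_meager.
  by move=> X /meager_sub_matching_set[J [y sub]]; exists J, y.
split=> // I; split=> //.
have [c cP] := choose_matching_set I.
have [d dP] := choose_matching_set singleton_partition.
pose f X := matching_set singleton_partition (c X).1 (c X).2.
pose g Y := matching_set I (d Y).1 (d Y).2.
have fP : {homo f : X / matching_family I X >-> meager_ideal X}.
  by move=> X _; exact: meager_matching_set.
have gP : {homo g : Y / meager_ideal Y >-> matching_family I Y}.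
  by move=> Y _; exists (d Y).1, (d Y).2.
exists (mkfun_fun fP), (mkfun_fun gP) => X Y MX MY fXY.
apply: subset_trans (cP X MX) _; apply: matching_set_sub_lift.
by apply: subset_trans fXY _; apply: dP; rewrite eq_meager.
Qed.
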